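(* For each $\mathsf{L}\in\{\mathsf{CN4K},\mathsf{CN4K}^\pm,\mathsf{CN4K}^\curlyvee,\mathsf{CN4K}^{\Join},\mathsf{CN4K}^1\}$, the set $\{\phi\in\mathcal{L}\mid\mathsf{L}\models\phi\}$ of $\mathsf{L}$-valid formulas is decidable.
   Context: Fix a countable set $\mathsf{Prop}$ of propositional variables. The language $\mathcal{L}$ is given by the grammar $\phi::=p\mid{\sim}\phi\mid(\phi\wedge\phi)\mid(\phi\vee\phi)\mid(\phi\to\phi)\mid\Box\phi\mid\Diamond\phi$ with $p\in\mathsf{Prop}$. A $\mathsf{CN4K}$ frame is a tuple $\mathfrak{F}=\langle W,\le,R^+_\Box,R^-_\Box,R^+_\Diamond,R^-_\Diamond\rangle$ where $W\neq\varnothing$, $\le$ is a preorder on $W$, and $R^+_\Box,R^-_\Box,R^+_\Diamond,R^-_\Diamond$ are arbitrary binary relations on $W$. $R(w)=\{w'\mid wRw'\}$. The frame is $\pm$-birelational if $R^+_\Box=R^+_\Diamond$ and $R^-_\Box=R^-_\Diamond$; $\curlyvee$-birelational if $R^+_\Box=R^-_\Box$ and $R^+_\Diamond=R^-_\Diamond$; $\Join$-birelational if $R^+_\Box=R^-_\Diamond$ and $R^+_\Diamond=R^-_\Box$; monorelational if all four relations coincide. A $\mathsf{CN4K}$ model is $\mathfrak{M}=\langle\mathfrak{F},v^+,v^-\rangle$ with $v^+,v^-:\mathsf{Prop}\to2^W$ upward closed under $\le$. Support: $w\Vdash^\pm p$ iff $w\in v^\pm(p)$; $w\Vdash^+{\sim}\phi$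 iff $w\Vdash^-\phi$; $w\Vdash^-{\sim}\phi$ iff $w\Vdash^+\phi$; $w\Vdash^+\phi\wedge\chi$ iff both; $w\Vdash^-\phi\wedge\chi$ iff $w\Vdash^-\phi$ or $w\Vdash^-\chi$; $w\Vdash^+\phi\vee\chi$ iff $w\Vdash^+\phi$ or $w\Vdash^+\chi$; $w\Vdash^-\phi\vee\chi$ iff both negatively supported; $w\Vdash^+\phi\to\chi$ iff for all $w'\ge w$, $w'\Vdash^+\phi$ implies $w'\Vdash^+\chi$; $w\Vdash^-\phi\to\chi$ iff $w\Vdash^+\phi$ and $w\Vdash^-\chi$; $w\Vdash^+\Box\phi$ iff $\forall w'\ge w\ \forall w''\in R^+_\Box(w')$: $w''\Vdash^+\phi$; $w\Vdash^-\Box\phi$ iff $\forall w'\ge w\ \exists w''\in R^-_\Box(w')$: $w''\Vdash^-\phi$; $w\Vdash^+\Diamond\phi$ iff $\forall w'\ge w\ \exists w''\in R^+_\Diamond(w')$: $w''\Vdash^+\phi$; $w\Vdash^-\Diamond\phi$ iff $\forall w'\ge w\ \forall w''\in R^-_\Diamond(w')$: $w''\Vdash^-\phi$. $\mathsf{CN4K}$, $\mathsf{CN4K}^\pm$, $\mathsf{CN4K}^\curlyvee$, $\mathsf{CN4K}^{\Join}$, $\mathsf{CN4K}^1$ are the logics of, respectively, all frames, $\pm$-birelational, $\curlyvee$-birelational, $\Join$-birelational, and monorelational frames; $\mathsf{L}\models\chi$ means $\mathfrak{M},w\Vdash^+\chi$ for every model $\mathfrak{M}$ on a frame of the class of $\mathsf{L}$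 and every state $w$ of $\mathfrak{M}$. *)

(* Defs.v *)
From Stdlib Require Import List Arith.
Import ListNotations.

Inductive form : Type :=
| Var : nat -> form
| Neg : form -> form
| And : form -> form -> form
| Or  : form -> form -> form
| Imp : form -> form -> form
| Box : form -> form
| Dia : form -> form.

Record frame : Type := {
  W : Type;
  W_inhabited : inhabited W;
  le : W -> W -> Prop;
  le_refl : forall w, le w w;
  le_trans : forall u v w, le u v -> le v w -> le u w;
  RbP : W -> W -> Prop;
  RbN : W -> W -> Prop;
  RdP : W -> W -> Prop;
  RdN : W -> W -> Prop
}.

Record model (F : frame) : Type := {
  vP : nat -> W F -> Prop;
  vN : nat -> W F -> Prop;
  vP_up : forall p w w', le F w w' -> vP p w -> vP p w';
  vN_up : forall p w w', le F w w' -> vN p w -> vN p w'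
}.

(** [supp M true phi w] is  w ||-^+ phi ;  [supp M false phi w] is  w ||-^- phi. *)
Fixpoint supp {F : frame} (M : model F) (pol : bool) (phi : form) (w : W F) : Prop :=
  match phi with
  | Var p => if pol then vP F M p w else vN F M p w
  | Neg a => supp M (negb pol) a w
  | And a b => if pol then supp M true a w /\ supp M true b w
               else supp M false a w \/ supp M false b w
  | Or a b => if pol then supp M true a w \/ supp M true b w
              else supp M false a w /\ supp M false b w
  | Imp a b => if pol then
                 forall w', le F w w' -> supp M true a w' -> supp M true b w'
               else supp M true a w /\ supp M false b w
  | Box a => if pol then
               forall w', le F w w' -> forall w'', RbP F w' w'' -> supp M true a w''
             else
               forall w', le F w w' -> exists w'', RbN F w' w'' /\ supp M false a w''
  | Dia a => if pol then
               forall w', le F w w' -> exists w'', RdP F w' w'' /\ supp M true a w''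
             else
               forall w', le F w w' -> forall w'', RdN F w' w'' -> supp M false a w''
  end.

Inductive logic : Type := CN4K | CN4K_pm | CN4K_vee | CN4K_bowtie | CN4K_1.

Definition rel_eq {T : Type} (R S : T -> T -> Prop) : Prop := forall x y, R x y <-> S x y.

Definition frame_class (L : logic) (F : frame) : Prop :=
  match L with
  | CN4K => True
  | CN4K_pm => rel_eq (RbP F) (RdP F) /\ rel_eq (RbN F) (RdN F)
  | CN4K_vee => rel_eq (RbP F) (RbN F) /\ rel_eq (RdP F) (RdN F)
  | CN4K_bowtie => rel_eq (RbP F) (RdN F) /\ rel_eq (RdP F) (RbN F)
  | CN4K_1 => rel_eq (RbP F) (RbN F) /\ rel_eq (RbP F) (RdP F) /\ rel_eq (RbP F) (RdN F)
  end.

Definition valid (L : logic) (phi : form) : Prop :=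
  forall (F : frame), frame_class L F ->
  forall (M : model F) (w : W F), supp M true phi w.

Inductive code : Type :=
| CZero : code
| CSucc : code
| CProj : nat -> code
| CComp : code -> list code -> code
| CPrim : code -> code -> code
| CMu : code -> code.

Inductive eval : code -> list nat -> nat -> Prop :=
| ev_zero : forall v, eval CZero v 0
| ev_succ : forall x v, eval CSucc (x :: v) (S x)
| ev_proj : forall i v, i < length v -> eval (CProj i) v (nth i v 0)
| ev_comp : forall f gs v ws y,
    evals gs v ws -> eval f ws y -> eval (CComp f gs) v y
| ev_prim0 : forall f g v y, eval f v y -> eval (CPrim f g) (0 :: v) y
| ev_primS : forall f g n v z y,
    eval (CPrim f g) (n :: v) z -> eval g (n :: z :: v) y ->
    eval (CPrim f g) (S n :: v) y
| ev_mu : forall f v n,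
    eval f (n :: v) 0 ->
    (forall m, m < n -> exists k, eval f (m :: v) (S k)) ->
    eval (CMu f) v n
with evals : list code -> list nat -> list nat -> Prop :=
| evs_nil : forall v, evals [] v []
| evs_cons : forall g gs v w ws,
    eval g v w -> evals gs v ws -> evals (g :: gs) v (w :: ws).

Definition cpair (a b : nat) : nat := (a + b) * (a + b + 1) / 2 + b.

Fixpoint enc (phi : form) : nat :=
  match phi with
  | Var p => cpair 0 p
  | Neg a => cpair 1 (enc a)
  | And a b => cpair 2 (cpair (enc a) (enc b))
  | Or a b => cpair 3 (cpair (enc a) (enc b))
  | Imp a b => cpair 4 (cpair (enc a) (enc b))
  | Box a => cpair 5 (enc a)
  | Dia a => cpair 6 (enc a)
  end.

Definition decidable_form (P : form -> Prop) : Prop :=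
  exists c : code, forall phi,
    (P phi -> eval c [enc phi] 1) /\ (~ P phi -> eval c [enc phi] 0).

(* Main.v *)
(** A type is a set of polarised formulas with codes below [S (enc phi)], and [phi] fails somewhere
    iff some set [S] of types, one of which omits [phi] positively, is good: it gives every implication
    and modality in or missing from a type of [S] the witnesses in [S] that it demands.  The types
    realised in a countermodel form a good set.  Conversely, a good set yields a countermodel whose
    worlds are segments [(g, U)], a type [g] with, for each accessibility relation, a set [U] of
    permitted successors, ordered by inclusion of types alone: a missing existential modality is
    refuted at a segment with the same type whose [U] excludes the types containing its argument.
    Coding types and sets of types by numbers through their bits, the existence of a good set is
    expressed with bounded quantifiers only, hence is computable. *)
From Stdlib Require Import List Arith Lia Classical Cantor Bool.
Require Import Defs.
Import ListNotations.

(** * Computable functions and relations *)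

Definition computable (n : nat) (f : list nat -> nat) : Prop :=
  exists c, forall v, length v = n -> eval c v (f v).

Lemma computable_ext n f g :
  (forall v, f v = g v) -> computable n f -> computable n g.
Proof.
  intros E [c Hc]. exists c. intros v Hv. rewrite <- E. auto.
Qed.

Lemma evals_proj v m : forall i, i + m = length v ->
  evals (map CProj (seq i m)) v (skipn i v).
Proof.
  induction m as [|m IH]; intros i Hi; cbn.
  - rewrite skipn_all2 by lia. constructor.
  - replace (skipn i v) with (nth i v 0 :: skipn (S i) v).
    + constructor; [constructor; lia | apply IH; lia].
    + assert (Hl : i < length v) by lia. clear - Hl. revert v Hl.
      induction i as [|i IHi]; intros [|x v] Hl; cbn in *; try lia; auto.
      apply IHi. lia.
Qed.

Lemma computable_const n k : computable n (fun _ => k).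
Proof.
  induction k as [|k [c Hc]].
  - exists CZero. constructor.
  - exists (CComp CSucc [c]). intros v Hv.
    econstructor; [repeat constructor; auto | constructor].
Qed.

Lemma computable_weaken n f :
  computable n f -> computable (S n) (fun v => f (tl v)).
Proof.
  intros [c Hc]. exists (CComp c (map CProj (seq 1 n))). intros [|x v] Hv; [discriminate|].
  injection Hv as Hv. econstructor; [apply (evals_proj (x :: v)); cbn; lia | auto].
Qed.

(** Bounded quantifiers prepend their variable to the argument list, so variables occur later as
    heads of iterated tails; the conclusion is shaped to unify with these. *)
Lemma computable_proj n i : i < n -> computable n (fun v => hd 0 (Nat.iter i (@tl nat) v)).
Proof.
  intros Hi. apply computable_ext with (fun v => nth i v 0).
  - clear Hi. induction i as [|i IH]; intros v; [destruct v; reflexivity|].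
    rewrite Nat.iter_succ_r, <- IH. destruct v; [destruct i|]; reflexivity.
  - exists (CProj i). intros v Hv. constructor. lia.
Qed.

Lemma computable_succ n f : computable n f -> computable n (fun v => S (f v)).
Proof.
  intros [c Hc]. exists (CComp CSucc [c]). intros v Hv.
  econstructor; [repeat constructor; auto | constructor].
Qed.

Lemma computable_rec n f t (g : nat -> nat -> list nat -> nat) :
  computable n f ->
  computable (S (S n)) (fun v => g (hd 0 v) (hd 0 (tl v)) (tl (tl v))) ->
  computable n t ->
  computable n (fun v => nat_rect (fun _ => nat) (f v) (fun m z => g m z v) (t v)).
Proof.
  intros [cf Hf] [cg Hg] [ct Ht].
  exists (CComp (CPrim cf cg) (ct :: map CProj (seq 0 n))). intros v Hv.
  apply ev_comp with (ws := t v :: v).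
  - constructor; auto. apply (evals_proj v n 0). auto.
  - induction (t v) as [|m IH]; cbn.
    + constructor. auto.
    + econstructor; [exact IH|].
      apply (Hg (_ :: _ :: v)). cbn. lia.
Qed.

Ltac comp_var :=
  first [ apply (computable_proj _ 0); lia | apply (computable_proj _ 1); lia
        | apply (computable_proj _ 2); lia | apply (computable_proj _ 3); lia
        | apply (computable_proj _ 4); lia | apply (computable_proj _ 5); lia
        | apply (computable_proj _ 6); lia | apply (computable_proj _ 7); lia ].

Lemma computable_add n f g :
  computable n f -> computable n g -> computable n (fun v => f v + g v).
Proof.
  intros Hf Hg.
  apply computable_ext with
    (f := fun v => nat_rect (fun _ => nat) (f v) (fun _ z => S z) (g v)).
  - intros v. induction (g v); cbn; lia.
  - apply computable_rec with (g := fun _ z _ => S z); auto.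
    apply computable_succ. comp_var.
Qed.

Lemma computable_mul n f g :
  computable n f -> computable n g -> computable n (fun v => f v * g v).
Proof.
  intros Hf Hg.
  apply computable_ext with
    (f := fun v => nat_rect (fun _ => nat) 0 (fun _ z => z + f v) (g v)).
  - intros v. induction (g v); cbn; lia.
  - apply computable_rec with (g := fun _ z v => z + f v); auto using computable_const.
    apply computable_add; [comp_var|].
    apply (computable_weaken (S n) (fun v => f (tl v))), computable_weaken, Hf.
Qed.

Lemma computable_pred n f : computable n f -> computable n (fun v => pred (f v)).
Proof.
  intros Hf.
  apply computable_ext with
    (f := fun v => nat_rect (fun _ => nat) 0 (fun m _ => m) (f v)).
  - intros v. destruct (f v); reflexivity.
  - apply computable_rec with (g := fun m _ _ => m); auto using computable_const.
    comp_var.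
Qed.

Lemma computable_sub n f g :
  computable n f -> computable n g -> computable n (fun v => f v - g v).
Proof.
  intros Hf Hg.
  apply computable_ext with
    (f := fun v => nat_rect (fun _ => nat) (f v) (fun _ z => pred z) (g v)).
  - intros v. induction (g v); cbn; lia.
  - apply computable_rec with (g := fun _ z _ => pred z); auto.
    apply computable_pred. comp_var.
Qed.

Lemma computable_pow2 n f : computable n f -> computable n (fun v => 2 ^ f v).
Proof.
  intros Hf.
  apply computable_ext with
    (f := fun v => nat_rect (fun _ => nat) 1 (fun _ z => z + z) (f v)).
  - intros v. induction (f v) as [|m IH]; [reflexivity|].
    cbn [nat_rect]. rewrite IH, Nat.pow_succ_r'. lia.
  - apply computable_rec with (g := fun _ z _ => z + z); auto using computable_const.
    apply computable_add; comp_var.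
Qed.

(** Halves of consecutive numbers [m] and [S m] add up to [m], so halving obeys the primitive
    recursion [m, z => m - z]. *)
Lemma computable_div2 n f : computable n f -> computable n (fun v => Nat.div2 (f v)).
Proof.
  intros Hf.
  apply computable_ext with
    (f := fun v => nat_rect (fun _ => nat) 0 (fun m z => m - z) (f v)).
  - intros v.
    assert (E : forall m, Nat.div2 (S m) + Nat.div2 m = m).
    { induction m as [|m IH]; [reflexivity|].
      change (Nat.div2 (S (S m))) with (S (Nat.div2 m)). lia. }
    induction (f v) as [|m IH]; [reflexivity|].
    cbn [nat_rect]. rewrite IH. specialize (E m). rewrite <- E at 1. apply Nat.add_sub.
  - apply computable_rec with (g := fun m z _ => m - z); auto using computable_const.
    apply computable_sub; comp_var.
Qed.

Lemma computable_cpair n f g :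
  computable n f -> computable n g -> computable n (fun v => cpair (f v) (g v)).
Proof.
  intros Hf Hg.
  apply computable_ext with
    (f := fun v => Nat.div2 ((f v + g v) * (f v + g v + 1)) + g v).
  - intros v. unfold cpair. rewrite Nat.div2_div. reflexivity.
  - repeat first [ assumption | apply computable_add | apply computable_div2
                 | apply computable_mul | apply computable_const ].
Qed.

(** Shift right by iterated halving, then compute the parity by iterating [z => 1 - z] from 0. *)
Lemma computable_testbit n f g :
  computable n f -> computable n g ->
  computable n (fun v => Nat.b2n (Nat.testbit (f v) (g v))).
Proof.
  intros Hf Hg.
  apply computable_ext with
    (f := fun v => nat_rect (fun _ => nat) 0 (fun _ z => 1 - z)
       (nat_rect (fun _ => nat) (f v) (fun _ z => Nat.div2 z) (g v))).
  - intros v. rewrite Nat.testbit_odd.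
    assert (E : nat_rect (fun _ => nat) (f v) (fun _ z => Nat.div2 z) (g v)
                = Nat.shiftr (f v) (g v)) by (induction (g v); cbn; congruence).
    rewrite E. clear E. induction (Nat.shiftr (f v) (g v)) as [|m IH]; [reflexivity|].
    cbn [nat_rect]. rewrite IH, Nat.odd_succ, <- Nat.negb_odd.
    destruct (Nat.odd m); reflexivity.
  - apply computable_rec with (g := fun _ z _ => 1 - z); auto using computable_const.
    + apply computable_sub; [apply computable_const | comp_var].
    + apply computable_rec with (g := fun _ z _ => Nat.div2 z); auto.
      apply computable_div2. comp_var.
Qed.

(** * Relations with a computable characteristic function *)

Definition decidable_rel (n : nat) (P : list nat -> Prop) : Prop :=
  exists f, computable n f /\ forall v, (P v /\ f v = 1) \/ (~ P v /\ f v = 0).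

Lemma decidable_rel_ext n P Q :
  (forall v, P v <-> Q v) -> decidable_rel n P -> decidable_rel n Q.
Proof.
  intros E (f & Hf & HP). exists f. split; auto.
  intros v. rewrite <- E. auto.
Qed.

(** Excluded middle picks one of two constant functions. This covers equations between keys, in
    which no coded variable occurs. *)
Lemma decidable_const n (A : Prop) : decidable_rel n (fun _ => A).
Proof.
  destruct (classic A).
  - exists (fun _ => 1). auto using computable_const.
  - exists (fun _ => 0). auto using computable_const.
Qed.

Lemma decidable_lt n f g :
  computable n f -> computable n g -> decidable_rel n (fun v => f v < g v).
Proof.
  intros Hf Hg. exists (fun v => 1 - (S (f v) - g v)). split.
  - repeat first [ assumption | apply computable_sub | apply computable_succ
                 | apply computable_const ].
  - intros v. lia.
Qed.

Lemma decidable_testbit n f g :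
  computable n f -> computable n g ->
  decidable_rel n (fun v => Nat.testbit (f v) (g v) = true).
Proof.
  intros Hf Hg. exists (fun v => Nat.b2n (Nat.testbit (f v) (g v))).
  split; [auto using computable_testbit|].
  intros v. destruct (Nat.testbit _ _); cbn; auto.
Qed.

Lemma decidable_not n P : decidable_rel n P -> decidable_rel n (fun v => ~ P v).
Proof.
  intros (f & Hf & HP). exists (fun v => 1 - f v). split.
  - apply computable_sub; auto using computable_const.
  - intros v. destruct (HP v) as [[? ->]|[? ->]]; auto.
Qed.

Lemma decidable_and n P Q :
  decidable_rel n P -> decidable_rel n Q -> decidable_rel n (fun v => P v /\ Q v).
Proof.
  intros (f & Hf & HP) (g & Hg & HQ). exists (fun v => f v * g v). split.
  - apply computable_mul; auto.
  - intros v. destruct (HP v) as [[? ->]|[? ->]], (HQ v) as [[? ->]|[? ->]]; tauto.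
Qed.

Lemma decidable_or n P Q :
  decidable_rel n P -> decidable_rel n Q -> decidable_rel n (fun v => P v \/ Q v).
Proof.
  intros HP HQ. apply decidable_rel_ext with (fun v => ~ (~ P v /\ ~ Q v)).
  - intros v. tauto.
  - auto using decidable_not, decidable_and.
Qed.

Lemma decidable_imp n P Q :
  decidable_rel n P -> decidable_rel n Q -> decidable_rel n (fun v => P v -> Q v).
Proof.
  intros HP HQ. apply decidable_rel_ext with (fun v => ~ (P v /\ ~ Q v)).
  - intros v. tauto.
  - auto using decidable_not, decidable_and.
Qed.

Lemma decidable_iff n P Q :
  decidable_rel n P -> decidable_rel n Q -> decidable_rel n (fun v => P v <-> Q v).
Proof.
  intros HP HQ. apply (decidable_and n (fun v => P v -> Q v) (fun v => Q v -> P v));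
    auto using decidable_imp.
Qed.

Lemma decidable_all_bool n (P : bool -> list nat -> Prop) :
  (forall b, decidable_rel n (P b)) -> decidable_rel n (fun v => forall b, P b v).
Proof.
  intros HP. apply decidable_rel_ext with (fun v => P true v /\ P false v).
  - intros v. split; [intros [? ?] []|]; auto.
  - auto using decidable_and.
Qed.

Lemma decidable_all n t (P : nat -> list nat -> Prop) :
  computable n t -> decidable_rel (S n) (fun v => P (hd 0 v) (tl v)) ->
  decidable_rel n (fun v => forall x, x < t v -> P x v).
Proof.
  intros Ht (f & Hf & HP).
  exists (fun v => nat_rect (fun _ => nat) 1 (fun m z => z * f (m :: v)) (t v)). split.
  - apply computable_rec with (g := fun m z v => z * f (m :: v));
      auto using computable_const.
    destruct Hf as [c Hc]. apply computable_mul; [comp_var|].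
    (* [CPrim] hands the step function the counter, the accumulator and [v], but [f] expects only
       the counter and [v]; these projections drop the accumulator. *)
    exists (CComp c (CProj 0 :: map CProj (seq 2 n))). intros [|x [|y v]] Hv; try discriminate.
    injection Hv as Hv. apply ev_comp with (ws := x :: v).
    + constructor; [apply (ev_proj 0 (x :: y :: v)) | apply (evals_proj (x :: y :: v))]; cbn; lia.
    + apply Hc. cbn. auto.
  - intros v. induction (t v) as [|m IH]; cbn [nat_rect].
    + left. split; [intros; lia | reflexivity].
    + destruct (HP (m :: v)) as [[Hm ->]|[Hm ->]]; cbn in Hm.
      * rewrite Nat.mul_1_r. destruct IH as [[IH ->]|[IH ->]].
        -- left. split; auto. intros x Hx.
           destruct (Nat.eq_dec x m) as [->|]; auto. apply IH. lia.
        -- right. split; [|reflexivity]. intros H. apply IH. auto.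
      * right. split; [intros H; apply Hm, H; lia | lia].
Qed.

Lemma decidable_ex n t (P : nat -> list nat -> Prop) :
  computable n t -> decidable_rel (S n) (fun v => P (hd 0 v) (tl v)) ->
  decidable_rel n (fun v => exists x, x < t v /\ P x v).
Proof.
  intros Ht HP.
  apply decidable_rel_ext with (fun v => ~ forall x, x < t v -> ~ P x v).
  - intros v. split.
    + intros H. apply NNPP. intros C. apply H. intros x Hx Px. apply C. eauto.
    + intros (x & Hx & Px) H. apply (H x); auto.
  - apply decidable_not, decidable_all; auto.
    apply (decidable_not (S n) (fun v => P (hd 0 v) (tl v))). auto.
Qed.

(** * Coding formulas and types *)

Lemma cpair_to_nat a b : cpair a b = to_nat (a, b).
Proof.
  pose proof (to_nat_spec a b) as E. unfold cpair.
  symmetry. apply Nat.add_cancel_r with (p := b).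
  replace ((a + b) * (a + b + 1)) with ((to_nat (a, b) - b) * 2).
  - rewrite Nat.div_mul by lia. pose proof (to_nat_non_decreasing a b). lia.
  - nia.
Qed.

Lemma cpair_ge a b : a + b <= cpair a b.
Proof.
  rewrite cpair_to_nat. pose proof (to_nat_non_decreasing a b). lia.
Qed.

(** Recursion happens only under a tag of at least 1, so the decoded argument is below [k] and fuel
    [S k] never runs out. Tags above 6 are read as [Dia]. *)
Fixpoint dec_fuel (fuel k : nat) : form :=
  match fuel with
  | 0 => Var 0
  | S f =>
      let (t, x) := of_nat k in
      let (a, b) := of_nat x in
      match t with
      | 0 => Var x
      | 1 => Neg (dec_fuel f x)
      | 2 => And (dec_fuel f a) (dec_fuel f b)
      | 3 => Or (dec_fuel f a) (dec_fuel f b)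
      | 4 => Imp (dec_fuel f a) (dec_fuel f b)
      | 5 => Box (dec_fuel f x)
      | _ => Dia (dec_fuel f x)
      end
  end.

(** Every number decodes to a formula, so types need not single out the codes of formulas. *)
Definition dec (k : nat) : form := dec_fuel (S k) k.

Lemma of_nat_le k t x : of_nat k = (t, x) -> t + x <= k.
Proof.
  intros E. rewrite <- (cancel_to_of k), E, <- cpair_to_nat. apply cpair_ge.
Qed.

Lemma dec_fuel_enough : forall k f f', k < f -> k < f' -> dec_fuel f k = dec_fuel f' k.
Proof.
  induction k as [k IH] using lt_wf_ind. intros [|f] [|f'] Hf Hf'; try lia.
  cbn [dec_fuel]. destruct (of_nat k) as [t x] eqn:Ek. apply of_nat_le in Ek.
  destruct (of_nat x) as [a b] eqn:Ex. apply of_nat_le in Ex.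
  do 6 (destruct t as [|t]; [f_equal; apply IH; lia|]). f_equal; apply IH; lia.
Qed.

Lemma dec_cpair t x : dec (cpair t x) =
  match t with
  | 0 => Var x
  | 1 => Neg (dec x)
  | 2 => let (a, b) := of_nat x in And (dec a) (dec b)
  | 3 => let (a, b) := of_nat x in Or (dec a) (dec b)
  | 4 => let (a, b) := of_nat x in Imp (dec a) (dec b)
  | 5 => Box (dec x)
  | _ => Dia (dec x)
  end.
Proof.
  unfold dec at 1. cbn [dec_fuel]. rewrite cpair_to_nat, cancel_of_to, <- cpair_to_nat.
  pose proof (cpair_ge t x). destruct (of_nat x) as [a b] eqn:Ex. apply of_nat_le in Ex.
  do 6 (destruct t as [|t]; [f_equal; apply dec_fuel_enough; lia|]).
  f_equal; apply dec_fuel_enough; lia.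
Qed.

Lemma of_nat_cpair a b : of_nat (cpair a b) = (a, b).
Proof. rewrite cpair_to_nat. apply cancel_of_to. Qed.

Lemma dec_enc phi : dec (enc phi) = phi.
Proof.
  induction phi; cbn [enc]; rewrite dec_cpair, ?of_nat_cpair; congruence.
Qed.

(** Excluded middle decides each bit in turn, so an arbitrary predicate becomes a number. This codes
    types as well as sets of types. *)
Lemma bits_exist (P : nat -> Prop) m :
  exists g, g < 2 ^ m /\ forall k, k < m -> (Nat.testbit g k = true <-> P k).
Proof.
  revert P. induction m as [|m IH]; intros P.
  - exists 0. split; [cbn; lia | lia].
  - destruct (IH (fun k => P (S k))) as (g & Hg & HP).
    destruct (classic (P 0)) as [H0|H0].
    + exists (2 * g + 1). split; [rewrite Nat.pow_succ_r'; lia|].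
      intros [|k] Hk; [rewrite Nat.testbit_odd_0; tauto|].
      rewrite Nat.testbit_odd_succ by lia. apply HP. lia.
    + exists (2 * g). split; [rewrite Nat.pow_succ_r'; lia|].
      intros [|k] Hk; [rewrite Nat.testbit_even_0; split; [discriminate | tauto]|].
      rewrite Nat.testbit_even_succ by lia. apply HP. lia.
Qed.

(** Bits [2 k] and [2 k + 1] of a type record negative and positive support of [dec k]. *)
Definition has (b : bool) (k g : nat) : Prop := Nat.testbit g (2 * k + Nat.b2n b) = true.

Lemma type_exists (P : bool -> nat -> Prop) n :
  exists g, g < 2 ^ (2 * n) /\ forall b k, k < n -> (has b k g <-> P b k).
Proof.
  destruct (bits_exist (fun i => P (Nat.odd i) (Nat.div2 i)) (2 * n)) as (g & Hg & HP).
  exists g. split; auto. intros b k Hk. unfold has. rewrite HP by (destruct b; cbn; lia).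
  replace (Nat.odd (2 * k + Nat.b2n b)) with b;
    [replace (Nat.div2 (2 * k + Nat.b2n b)) with k; [reflexivity|]|].
  - rewrite Nat.div2_div. destruct b; cbn [Nat.b2n].
    + apply Nat.div_unique with 1; lia.
    + apply Nat.div_unique with 0; lia.
  - rewrite Nat.odd_add, Nat.odd_mul. destruct b; reflexivity.
Qed.

(** * Accessibility relations, frame classes and support clauses *)

Definition rel (F : frame) (box pol : bool) : W F -> W F -> Prop :=
  match box, pol with
  | true, true => RbP F
  | true, false => RbN F
  | false, true => RdP F
  | false, false => RdN F
  end.

(** A label for each of the four relations: two relations get the same label exactly when [L]
    requires them to coincide. This lets one proof serve all five logics. *)
Definition key (L : logic) (box pol : bool) : bool * bool :=
  match L with
  | CN4K => (box, pol)
  | CN4K_pm => (true, pol)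
  | CN4K_vee => (box, true)
  | CN4K_bowtie => (eqb box pol, true)
  | CN4K_1 => (true, true)
  end.

Lemma frame_class_key L F : frame_class L F <->
  forall box pol box' pol', key L box pol = key L box' pol' ->
    rel_eq (rel F box pol) (rel F box' pol').
Proof.
  split.
  - intros H box pol box' pol' E x y.
    destruct L; cbn in H;
      repeat match goal with
        | H : _ /\ _ |- _ => destruct H
        | H : rel_eq _ _ |- _ => specialize (H x y)
      end;
      destruct box, pol, box', pol'; cbn in *; try discriminate; tauto.
  - intros H. destruct L; cbn; auto.
    + exact (conj (H true true false true eq_refl) (H true false false false eq_refl)).
    + exact (conj (H true true true false eq_refl) (H false true false false eq_refl)).
    + exact (conj (H true true false false eq_refl) (H false true true false eq_refl)).
    + exact (conj (H true true true false eq_refl)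
        (conj (H true true false true eq_refl) (H true true false false eq_refl))).
Qed.

(** At polarity [b], [ctag b] is the code of the connective read conjunctively, and [utag b] and
    [etag b] are those of the modalities read universally and existentially; [Box] is universal
    at positive and existential at negative polarity, and dually for [Dia]. *)
Definition ctag (b : bool) : nat := if b then 2 else 3.
Definition utag (b : bool) : nat := if b then 5 else 6.
Definition etag (b : bool) : nat := if b then 6 else 5.
(** The universal modality at polarity [b] is [Box] exactly when [b] is [true], whence the flags
    [b b]; the existential one is the other modality, whence [negb b]. *)
Definition ukey (L : logic) (b : bool) := key L b b.
Definition ekey (L : logic) (b : bool) := key L (negb b) b.
Definition urel (F : frame) (b : bool) := rel F b b.
Definition erel (F : frame) (b : bool) := rel F (negb b) b.

Section Semantics.
Context {F : frame} (M : model F).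

Lemma supp_up phi : forall b w w', le F w w' -> supp M b phi w -> supp M b phi w'.
Proof.
  induction phi; intros b w w' Hle; destruct b; cbn;
    try solve [ apply vP_up; assumption | apply vN_up; assumption
              | apply IHphi; assumption
              | intros H u Hu; apply H; apply le_trans with w'; assumption
              | intros [H1 H2]; split; [apply (IHphi1 _ _ _ Hle H1) | apply (IHphi2 _ _ _ Hle H2)]
              | intros [H1|H2]; [left; apply (IHphi1 _ _ _ Hle H1) | right; apply (IHphi2 _ _ _ Hle H2)] ].
Qed.

Lemma supp_neg k b w : supp M b (dec (cpair 1 k)) w <-> supp M (negb b) (dec k) w.
Proof. rewrite dec_cpair. reflexivity. Qed.

Lemma supp_conj k l b w : supp M b (dec (cpair (ctag b) (cpair k l))) w <->
  supp M b (dec k) w /\ supp M b (dec l) w.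
Proof. rewrite dec_cpair, of_nat_cpair. destruct b; reflexivity. Qed.

Lemma supp_disj k l b w : supp M b (dec (cpair (ctag (negb b)) (cpair k l))) w <->
  supp M b (dec k) w \/ supp M b (dec l) w.
Proof. rewrite dec_cpair, of_nat_cpair. destruct b; reflexivity. Qed.

Lemma supp_imp k l w : supp M true (dec (cpair 4 (cpair k l))) w <->
  forall w', le F w w' -> supp M true (dec k) w' -> supp M true (dec l) w'.
Proof. rewrite dec_cpair, of_nat_cpair. reflexivity. Qed.

Lemma supp_nimp k l w : supp M false (dec (cpair 4 (cpair k l))) w <->
  supp M true (dec k) w /\ supp M false (dec l) w.
Proof. rewrite dec_cpair, of_nat_cpair. reflexivity. Qed.

Lemma supp_univ k b w : supp M b (dec (cpair (utag b) k)) w <->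
  forall w', le F w w' -> forall u, urel F b w' u -> supp M b (dec k) u.
Proof. rewrite dec_cpair. destruct b; reflexivity. Qed.

Lemma supp_exis k b w : supp M b (dec (cpair (etag b) k)) w <->
  forall w', le F w w' -> exists u, erel F b w' u /\ supp M b (dec k) u.
Proof. rewrite dec_cpair. destruct b; reflexivity. Qed.
End Semantics.

(** * Good sets of types *)

Definition sub (n g h : nat) : Prop :=
  forall k, k < n -> forall b, has b k g -> has b k h.

(** Canonical accessibility between types. If [L] identifies [RbP] with [RdN], both universal
    modalities carry the same label and constrain the same step. *)
Definition step (L : logic) (n : nat) (r : bool * bool) (g h : nat) : Prop :=
  forall k, k < n -> forall b, ukey L b = r ->
    cpair (utag b) k < n -> has b (cpair (utag b) k) g -> has b k h.

Definition mem (s g : nat) : Prop := Nat.testbit s g = true.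

Definition locally_good (n g : nat) : Prop :=
  forall k, k < n -> forall b,
    (cpair 1 k < n -> (has b (cpair 1 k) g <-> has (negb b) k g)) /\
    forall l, l < n ->
      (cpair (ctag b) (cpair k l) < n ->
        (has b (cpair (ctag b) (cpair k l)) g <-> has b k g /\ has b l g)) /\
      (cpair (ctag (negb b)) (cpair k l) < n ->
        (has b (cpair (ctag (negb b)) (cpair k l)) g <-> has b k g \/ has b l g)) /\
      (cpair 4 (cpair k l) < n ->
        (has false (cpair 4 (cpair k l)) g <-> has true k g /\ has false l g)).

Definition imp_good (n s g : nat) : Prop :=
  forall k, k < n -> forall l, l < n -> cpair 4 (cpair k l) < n ->
    (has true (cpair 4 (cpair k l)) g <->
     forall h, h < 2 ^ (2 * n) -> mem s h -> sub n g h -> has true k h -> has true l h).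

(** Types above [g] need not be quantified over: a step from a type including [g] is also a step
    from [g]. *)
Definition univ_good (L : logic) (n s g : nat) : Prop :=
  forall k, k < n -> forall b, cpair (utag b) k < n ->
    (has b (cpair (utag b) k) g <->
     forall h, h < 2 ^ (2 * n) -> mem s h -> step L n (ukey L b) g h -> has b k h).

(** The second half treats one missing existential formula at a time, because each of them will be
    refuted at a segment of its own. *)
Definition exis_good (L : logic) (n s g : nat) : Prop :=
  forall k, k < n -> forall b, cpair (etag b) k < n -> has b (cpair (etag b) k) g ->
    (exists h, h < 2 ^ (2 * n) /\ mem s h /\ step L n (ekey L b) g h /\ has b k h) /\
    forall l, l < n -> forall b', ekey L b' = ekey L b ->
      cpair (etag b') l < n -> ~ has b' (cpair (etag b') l) g ->
      exists h, h < 2 ^ (2 * n) /\ mem s h /\ step L n (ekey L b) g h /\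
        has b k h /\ ~ has b' l h.

Definition good (L : logic) (n s : nat) : Prop :=
  forall g, g < 2 ^ (2 * n) -> mem s g ->
    locally_good n g /\ imp_good n s g /\ univ_good L n s g /\ exis_good L n s g.

(** With codes below [S k], which include [k] itself, a type has [2 * S k] bits and a set of types
    has one bit per type; this gives the two bounds. *)
Definition refutable (L : logic) (k : nat) : Prop :=
  exists s, s < 2 ^ 2 ^ (2 * S k) /\
    (good L (S k) s /\
     exists g, g < 2 ^ (2 * S k) /\ (mem s g /\ ~ has true k g)).

(** * From models to good sets *)

Section Soundness.
Context {F : frame} (M : model F) (L : logic) (n s : nat).
Hypothesis FL : frame_class L F.

Definition is_type (g : nat) (w : W F) : Prop :=
  g < 2 ^ (2 * n) /\ forall b k, k < n -> (has b k g <-> supp M b (dec k) w).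

Hypothesis Hs : forall g, g < 2 ^ (2 * n) -> (mem s g <-> exists w, is_type g w).

Lemma is_type_exists w : exists g, g < 2 ^ (2 * n) /\ mem s g /\ is_type g w.
Proof.
  destruct (type_exists (fun b k => supp M b (dec k) w) n) as (g & Hg & HP).
  exists g. split; auto. split; [|split; auto]. apply Hs; auto. exists w. split; auto.
Qed.

(** A universal formula labelled [r] in [g] speaks about a relation that the frame class equates
    with [rel F b b'], so it reaches [u] through [w']. *)
Lemma rel_step r b b' w w' u g h :
  is_type g w -> is_type h u -> le F w w' -> r = key L b b' -> rel F b b' w' u ->
  step L n r g h.
Proof.
  intros [_ Hg] [_ Hh] Hle -> Hr k Hk c E Hc Hin. apply Hh; auto.
  apply Hg in Hin; auto. rewrite supp_univ in Hin. apply (Hin w' Hle).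
  apply (proj1 (frame_class_key L F) FL b b'); auto.
Qed.

Lemma types_good : good L n s.
Proof.
  intros g Hg Hm. apply Hs in Hm as [w Hw]; auto. pose proof Hw as [_ T].
  split; [|split; [|split]].
  - intros k Hk b. split.
    + intros Hc. rewrite !T by auto. apply supp_neg.
    + intros l Hl. split; [|split]; intros Hc; rewrite !T by auto.
      * apply supp_conj.
      * apply supp_disj.
      * apply supp_nimp.
  - intros k Hk l Hl Hc. rewrite T, supp_imp by auto. split.
    + intros H h Hh Hmh Hsub. apply Hs in Hmh as [u [_ Tu]]; auto.
      (* [h] need not be realised above [w], but it inherits the implication from [g]. *)
      intros Hkh.
      assert (Hi : has true (cpair 4 (cpair k l)) h).
      { apply Hsub; auto. apply T; auto. apply supp_imp. exact H. }
      apply Tu in Hi; auto. rewrite supp_imp in Hi. apply Tu; auto.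
      apply Hi; [apply le_refl | apply Tu; auto].
    (* By persistence the type of [w'] includes [g], so the hypothesis applies to it. *)
    + intros H w' Hle. destruct (is_type_exists w') as (h & Hh & Hmh & _ & T').
      rewrite <- !T' by auto. apply H; auto.
      intros i Hi b Hb. apply T'; auto. apply supp_up with w; auto. apply T; auto.
  - intros k Hk b Hc. split.
    + intros H h Hh Hmh Hst. apply (Hst k Hk b); auto.
    + intros H. apply T; auto. apply supp_univ. intros w' Hle u Hu.
      destruct (is_type_exists u) as (h & Hh & Hmh & Tu).
      apply Tu; auto. apply H; auto.
      apply (rel_step _ b b w w' u g h); auto.
  - intros k Hk b Hc Hin. apply T in Hin; auto. rewrite supp_exis in Hin. split.
    + destruct (Hin w (le_refl F w)) as (u & Hu & Su).
      destruct (is_type_exists u) as (h & Hh & Hmh & Tu).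
      exists h. repeat split; auto.
      * apply (rel_step _ (negb b) b w w u g h); auto using le_refl.
      * apply Tu; auto.
    (* The missing formula fails because some [w'] above [w] has no suitable successor; the witness
       that the present formula has at this same [w'] therefore avoids [l]. *)
    + intros l Hl b' E Hc' Hn. rewrite T, supp_exis in Hn by auto.
      apply not_all_ex_not in Hn as [w' Hn]. apply imply_to_and in Hn as [Hle Hn].
      destruct (Hin w' Hle) as (u & Hu & Su).
      destruct (is_type_exists u) as (h & Hh & Hmh & Tu).
      exists h. repeat split; auto.
      * apply (rel_step _ (negb b) b w w' u g h); auto.
      * apply Tu; auto.
      * intros Hl'. apply Hn. exists u. split; [|apply Tu; auto].
        apply (proj1 (frame_class_key L F) FL (negb b) b); auto.
Qed.
End Soundness.

(** * From good sets to models *)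

Section Completeness.
Context (L : logic) (n s : nat).
Hypothesis Hgood : good L n s.

Definition is_seg (g : nat) (U : bool * bool -> nat -> Prop) : Prop :=
  g < 2 ^ (2 * n) /\ mem s g /\
  forall k b, k < n -> cpair (etag b) k < n -> has b (cpair (etag b) k) g ->
    exists h, h < 2 ^ (2 * n) /\ mem s h /\ step L n (ekey L b) g h /\
      U (ekey L b) h /\ has b k h.

Record segment : Type := {
  ty : nat;
  allowed : bool * bool -> nat -> Prop;
  seg_ok : is_seg ty allowed
}.

Definition seg_le (x y : segment) : Prop := sub n (ty x) (ty y).

Definition seg_rel (r : bool * bool) (x y : segment) : Prop :=
  step L n r (ty x) (ty y) /\ allowed x r (ty y).

Lemma seg_full g : g < 2 ^ (2 * n) -> mem s g -> is_seg g (fun _ _ => True).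
Proof.
  intros Hg Hm. split; [|split]; auto. intros k b Hk Hc Hin.
  destruct (Hgood g Hg Hm) as (_ & _ & _ & H).
  destruct (H k Hk b Hc Hin) as [(h & ? & ? & ? & ?) _]. exists h. auto.
Qed.

Definition full g (Hg : g < 2 ^ (2 * n)) (Hm : mem s g) : segment :=
  {| ty := g; seg_ok := seg_full g Hg Hm |}.

Definition seg_frame (x : segment) : frame.
Proof.
  refine {| W := segment; W_inhabited := inhabits x; le := seg_le;
    RbP := seg_rel (key L true true); RbN := seg_rel (key L true false);
    RdP := seg_rel (key L false true); RdN := seg_rel (key L false false) |}.
  - intros w k _ b H. exact H.
  - intros u v w Huv Hvw k Hk b H. apply Hvw, Huv; auto.
Defined.

Lemma seg_frame_class x : frame_class L (seg_frame x).
Proof.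
  apply frame_class_key. intros b p b' p' E y z.
  assert (Hr : forall c q, rel (seg_frame x) c q = seg_rel (key L c q)).
  { intros [] []; reflexivity. }
  rewrite !Hr, E. reflexivity.
Qed.

(** The guard [cpair 0 p < n] makes the valuations upward closed, since [sub] compares only codes
    below [n]. *)
Definition seg_model (x : segment) : model (seg_frame x).
Proof.
  refine (Build_model (seg_frame x)
    (fun p (w : segment) => cpair 0 p < n /\ has true (cpair 0 p) (ty w))
    (fun p (w : segment) => cpair 0 p < n /\ has false (cpair 0 p) (ty w)) _ _).
  - intros p w w' Hle [Hp H]. split; [|apply Hle]; auto.
  - intros p w w' Hle [Hp H]. split; [|apply Hle]; auto.
Defined.

Lemma local_of w : locally_good n (ty w).
Proof. destruct (seg_ok w) as (Hg & Hm & _). apply Hgood; auto. Qed.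

Section Modal.
Context (x : segment) (a : form) (b : bool).
Hypothesis Ha : enc a < n.
Hypothesis IH : forall w : segment, supp (seg_model x) b a w <-> has b (enc a) (ty w).

Lemma truth_univ (w : segment) : cpair (utag b) (enc a) < n ->
  (supp (seg_model x) b (if b then Box a else Dia a) w <->
   has b (cpair (utag b) (enc a)) (ty w)).
Proof.
  intros Hc. destruct (seg_ok w) as (Hg & Hm & _).
  destruct (Hgood (ty w) Hg Hm) as (_ & _ & Hu & _).
  transitivity (forall w', seg_le w w' -> forall u, seg_rel (ukey L b) w' u ->
    supp (seg_model x) b a u).
  { destruct b; reflexivity. }
  split.
  (* The unrestricted segment on the type of [w] lies above [w] and sees every type reached by a
     step. *)
  - intros H. apply Hu; auto. intros h Hh Hmh Hst.
    apply (IH (full h Hh Hmh)). apply (H (full (ty w) Hg Hm)).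
    + intros k _ c Hk. exact Hk.
    + split; [exact Hst | exact I].
  - intros H w' Hle u [Hst _]. apply IH. apply (Hst (enc a) Ha b); auto.
Qed.

Lemma truth_exis (w : segment) : cpair (etag b) (enc a) < n ->
  (supp (seg_model x) b (if b then Dia a else Box a) w <->
   has b (cpair (etag b) (enc a)) (ty w)).
Proof.
  intros Hc. transitivity (forall w', seg_le w w' -> exists u, seg_rel (ekey L b) w' u /\
    supp (seg_model x) b a u).
  { destruct b; reflexivity. }
  split.
  - intros H. apply NNPP. intros Hn.
    destruct (seg_ok w) as (Hg & Hm & _).
    destruct (Hgood (ty w) Hg Hm) as (_ & _ & _ & He).
    (* Only the label of the missing formula is restricted. Present formulas with another label keep
       any witness; those with this label use the second half of [exis_good]. *)
    set (U := fun r h => r = ekey L b -> ~ has b (enc a) h).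
    assert (HU : is_seg (ty w) U).
    { split; [|split]; auto. intros k c Hk Hkc Hin.
      destruct (He k Hk c Hkc Hin) as [(h & Hh & Hmh & Hst & Hkh) H2].
      destruct (classic (ekey L b = ekey L c)) as [E|E].
      - destruct (H2 (enc a) Ha b E Hc Hn) as (h' & ? & ? & ? & ? & ?).
        exists h'. unfold U. auto.
      - exists h. unfold U. repeat split; auto. }
    destruct (H {| ty := ty w; seg_ok := HU |}) as (u & [_ Hu] & Su).
    + intros k _ c Hk. exact Hk.
    + apply Hu; [reflexivity|]. apply IH. exact Su.
  (* The formula persists to [w'], whose segment condition provides a permitted witness type; the
     unrestricted segment on that type is the successor. *)
  - intros H w' Hle. apply Hle in H; auto.
    destruct (seg_ok w') as (_ & _ & Hw').
    destruct (Hw' (enc a) b Ha Hc H) as (h & Hh & Hmh & Hst & HU & Hin).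
    exists (full h Hh Hmh). split; [split; assumption|]. apply IH. exact Hin.
Qed.
End Modal.

(** Induction on [phi]: by [cpair_ge] codes of subformulas are smaller, so they stay below [n] where
    goodness applies. *)
Lemma truth x phi : enc phi < n -> forall b (w : segment),
  supp (seg_model x) b phi w <-> has b (enc phi) (ty w).
Proof.
  induction phi as [p|a IHa|a IHa c IHc|a IHa c IHc|a IHa c IHc|a IHa|a IHa];
    cbn [enc]; intros Hn b w.
  - destruct b; cbn; tauto.
  - pose proof (cpair_ge 1 (enc a)).
    destruct (local_of w (enc a) ltac:(lia) b) as [Hl _].
    rewrite Hl by auto. apply IHa. lia.
  - pose proof (cpair_ge 2 (cpair (enc a) (enc c))). pose proof (cpair_ge (enc a) (enc c)).
    destruct (local_of w (enc a) ltac:(lia) b) as [_ Hl].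
    destruct (Hl (enc c) ltac:(lia)) as (Hc & Hd & _).
    (* At negative polarity [And] behaves disjunctively, and its tag 2 is then [ctag (negb b)]. *)
    destruct b; [rewrite Hc by auto | rewrite Hd by auto];
      cbn; rewrite IHa, IHc by lia; reflexivity.
  - pose proof (cpair_ge 3 (cpair (enc a) (enc c))). pose proof (cpair_ge (enc a) (enc c)).
    destruct (local_of w (enc a) ltac:(lia) b) as [_ Hl].
    destruct (Hl (enc c) ltac:(lia)) as (Hc & Hd & _).
    destruct b; [rewrite Hd by auto | rewrite Hc by auto];
      cbn; rewrite IHa, IHc by lia; reflexivity.
  - pose proof (cpair_ge 4 (cpair (enc a) (enc c))). pose proof (cpair_ge (enc a) (enc c)).
    destruct b.
    + cbn. destruct (seg_ok w) as (Hg & Hm & _).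
      destruct (Hgood (ty w) Hg Hm) as (_ & Hi & _).
      rewrite (Hi (enc a) ltac:(lia) (enc c) ltac:(lia)) by auto. split.
      * intros H1 h Hh Hmh Hsub. specialize (H1 (full h Hh Hmh) Hsub).
        rewrite IHa, IHc in H1 by lia. exact H1.
      * intros H1 w' Hle. rewrite IHa, IHc by lia. destruct (seg_ok w') as (Hg' & Hm' & _).
        apply H1; auto.
    + destruct (local_of w (enc a) ltac:(lia) true) as [_ Hl].
      destruct (Hl (enc c) ltac:(lia)) as (_ & _ & Hi).
      rewrite Hi by auto. cbn. rewrite IHa, IHc by lia. reflexivity.
  - pose proof (cpair_ge 5 (enc a)). destruct b.
    + apply (truth_univ x a true); auto; try lia. apply IHa. lia.
    + apply (truth_exis x a false); auto; try lia. apply IHa. lia.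
  - pose proof (cpair_ge 6 (enc a)). destruct b.
    + apply (truth_exis x a true); auto; try lia. apply IHa. lia.
    + apply (truth_univ x a false); auto; try lia. apply IHa. lia.
Qed.
End Completeness.

(** * Decidability *)

Lemma valid_iff L phi : valid L phi <-> ~ refutable L (enc phi).
Proof.
  split.
  - intros Hv (s & _ & Hgood & g & Hg & Hm & Hn).
    pose (x := full L (S (enc phi)) s Hgood g Hg Hm).
    apply Hn. apply (truth L (S (enc phi)) s Hgood x phi (Nat.lt_succ_diag_r _) true x).
    apply Hv. apply seg_frame_class.
  - intros Hn F FL M w. apply NNPP. intros Hw. apply Hn.
    set (n := S (enc phi)) in *.
    (* However large the model, the types it realises are numbers below [2 ^ (2 * n)], so their set
       is coded by a single number. *)
    destruct (bits_exist (fun g => exists u, is_type M n g u) (2 ^ (2 * n)))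
      as (s & Hs & Hbits).
    exists s. split; auto. split.
    + apply (types_good M L n s FL). exact Hbits.
    + destruct (is_type_exists M n s Hbits w) as (g & Hg & Hm & _ & T).
      exists g. repeat split; auto. rewrite T, dec_enc by (unfold n; lia). exact Hw.
Qed.

(** Follows the syntax of the unfolded definition, one closure lemma per connective or bounded
    quantifier. *)
Ltac decide_rel :=
  lazymatch goal with
  | |- decidable_rel _ (fun v => forall x, x < _ -> _) => apply decidable_all
  | |- decidable_rel _ (fun v => forall b : bool, _) => apply decidable_all_bool; intros ?
  | |- decidable_rel _ (fun v => exists x, x < _ /\ _) => apply decidable_ex
  | |- decidable_rel _ (fun v => _ /\ _) => apply decidable_and
  | |- decidable_rel _ (fun v => _ \/ _) => apply decidable_or
  | |- decidable_rel _ (fun v => _ <-> _) => apply decidable_iff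
  | |- decidable_rel _ (fun v => ~ _) => apply decidable_not
  | |- decidable_rel _ (fun v => _ -> _) => apply decidable_imp
  | |- decidable_rel _ (fun v => _ < _) => apply decidable_lt
  | |- decidable_rel _ (fun v => Nat.testbit _ _ = true) => apply decidable_testbit
  | |- decidable_rel _ _ => apply decidable_const
  | |- computable _ (fun v => _ + _) => apply computable_add
  | |- computable _ (fun v => 2 * _) => apply computable_mul
  | |- computable _ (fun v => 2 ^ _) => apply computable_pow2
  | |- computable _ (fun v => cpair _ _) => apply computable_cpair
  | |- computable _ (fun v => S _) => apply computable_succ
  | |- computable _ _ =>
      first [ apply computable_const | comp_var ]
  end.

Lemma decidable_refutable L : decidable_rel 1 (fun v => refutable L (hd 0 v)).
Proof.
  unfold refutable, good, locally_good, imp_good, univ_good, exis_good, sub, step, mem, has.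
  repeat decide_rel.
Qed.

Theorem theorem7 : forall L : logic, decidable_form (valid L).
Proof.
  intros L. destruct (decidable_refutable L) as (f & Hf & Hr).
  (* [f] is the characteristic function of refutability, so [1 - f] is that of validity. *)
  destruct (computable_sub 1 (fun _ => 1) f (computable_const 1 1) Hf) as [c Hc].
  exists c. intros phi. specialize (Hc [enc phi] eq_refl). specialize (Hr [enc phi]).
  cbn [hd] in Hr. cbv beta in Hc. rewrite valid_iff.
  destruct Hr as [[Hr E]|[Hr E]]; rewrite E in Hc; split; intros H; auto; tauto.
Qed.
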